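(* Let $p,r$ be distinct primes, $F$ a field of characteristic $\ell\neq r$ and let $G=G_{r,p}$. Then the following are equivalent: $(1)$ there exists a faithful unisingular irreducible representation of $G$ over $F$; $(2)$ every $r$-element of $G$ fixes a point on some faithful $r$-restricted permutational $G$-set $\Delta$.
   Context: For distinct primes $p,r$, $G_{r,p}$ denotes a non-abelian group of minimal order $r^dp$ having a normal $r$-subgroup $A$ of index $p$. There is only one such group for given $p,r$; $A$ is an elementary abelian $r$-group of rank $d$, and the conjugation action of $G_{r,p}$ on $A$ is irreducible, in the sense that $A$ has no non-trivial proper $G_{r,p}$-invariant subgroup. A representation $\phi$ of a finite group $G$ over a field is called unisingular if $\phi(g)$ has eigenvalue $1$ for every $g\in G$. A (permutational) $G$-set is a set on which $G$ acts by permutations. For a prime $s$, a $G$-set $\Omega$ is called $s$-restricted if for every elementary abelian $s$-subgroup $B$ of $G$ all $B$-orbits on $\Omega$ are of size at most $s$.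
   Formalization: In (2) the G-set Δ is required to be transitive (otherwise adding a global fixed point makes (2) always true, while (1) fails for S_3 = G_{3,2}), and the minimal order defining G_{r,p} is taken among groups whose subgroup A is elementary abelian. *)

(* Defs.v *)
From mathcomp Require Import all_boot all_order all_algebra.
From mathcomp Require Import all_fingroup all_solvable all_character.

Set Implicit Arguments.
Unset Strict Implicit.
Unset Printing Implicit Defensive.

Import GroupScope.

Definition nonabelian_ext (r p : nat) (gT : finGroupType)
    (G A : {group gT}) : Prop :=
  [/\ ~~ abelian G, A <| G, r.-abelem A & #|G : A| = p].

(* "G is a G_{r,p}".  The minimum is taken over the groups whose normal        *)
(* r-subgroup of index p is elementary abelian: without that restriction it   *)
(* could be attained at Q x C_p with Q a non-abelian group of order r ^ 3,    *)
(* which has an order smaller than the intended r ^ d * p as soon as 3 < d.   *)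
Definition minimal_nonabelian_ext (r p : nat) (gT : finGroupType)
    (G : {group gT}) : Prop :=
  (exists A : {group gT}, nonabelian_ext r p G A) /\
  (forall (hT : finGroupType) (H B : {group hT}),
     nonabelian_ext r p H B -> #|G| <= #|H|).

Definition unisingular (F : fieldType) (gT : finGroupType) (G : {group gT})
    (n : nat) (rG : mx_representation F G n) : Prop :=
  forall g, g \in G -> eigenvalue (rG g) 1%R.

Definition restricted_action (s : nat) (gT : finGroupType) (G : {group gT})
    (Omega : finType) (to : action G Omega) : Prop :=
  forall B : {group gT}, B \subset G -> s.-abelem B ->
  forall x : Omega, #|orbit to B x| <= s.

(* Main.v *)
(* By minimality [A] is a minimal normal subgroup of [G], and its own         *)
(* centralizer. An irreducible representation [V] of [G] that is nontrivial   *)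
(* on [A] has no nonzero [A]-fixed vector, so for distinct maximal subgroups  *)
(* [K], [L] of [A] the sum of the elements of [L] kills the [K]-fixed         *)
(* vectors. The kernel [K] in [A] of a simple [A]-submodule of [V] is maximal *)
(* in [A], because an abelian group with a faithful irreducible               *)
(* representation is cyclic. If [a] in [A] lies in no conjugate of [K], then  *)
(* the sum of the powers of [a] kills the fixed spaces of all the conjugates  *)
(* of [K], which span [V], so [a] fixes no nonzero vector. Hence              *)
(* unisingularity forces the conjugates of [K] to cover [A], and [G] acts on  *)
(* the cosets of [K] as required. Conversely, the stabilizer in [A] of a      *)
(* point of [Delta] is a maximal subgroup [K] of [A] whose conjugates cover   *)
(* [A]. Every nonzero submodule of the permutation module contains a nonzero  *)
(* [K]-fixed vector, and a simple submodule of the part killed by the sum of  *)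
(* [A] is nontrivial on [A]. For [g] outside [A], adding up the               *)
(* [<[g]>]-translates of a [K]-fixed vector gives a [g]-fixed vector; it is   *)
(* nonzero because these translates are fixed by distinct conjugates of [K].  *)

Require Import Defs.
From mathcomp Require Import all_boot all_order all_algebra.
From mathcomp Require Import all_fingroup all_solvable all_character.
From Stdlib Require Import Classical.

Set Implicit Arguments.
Unset Strict Implicit.
Unset Printing Implicit Defensive.

Import GroupScope GRing.Theory.

(** Both conditions amount to the existence of a maximal subgroup [K] of [A] whose [G]-conjugates
    cover [A]. A unisingular representation yields such a [K] by [exists_cocyclic_rfix] and
    [unisingular_cover], and [coset_action_exists] turns [K] into a [G]-set. A [G]-set yields [K] as
    a point stabilizer in [A]; [exists_irr_rfix] then finds a simple constituent of the permutation
    module with [K]-fixed vectors, and [irr_hyperplane_faithful_unisingular] shows that it is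
    faithful and unisingular. *)

(** * Normal subgroups of a minimal extension *)

(** For [B] nontrivial and proper in [A], minimality makes both [G / B] and [B <*> P] abelian, with
    [P] a Sylow [p]-subgroup. So [P] centralizes [A / B] and [B], hence [A] by coprime action, and
    [G = A * P] would be abelian. *)
Lemma minimal_ext_irreducible (p r : nat) (gT : finGroupType)
    (G A B : {group gT}) (pr_p : prime p) (p'r : p != r)
    (minG : forall (hT : finGroupType) (H C : {group hT}),
       nonabelian_ext r p H C -> #|G| <= #|H|)
    (extG : nonabelian_ext r p G A) (nsBG : B <| G) (sBA : B \subset A) :
  B :=: 1 \/ B :=: A.
Proof.
case: extG => ncG nsAG abA iAG.
have [/eqP-> | ntB] := boolP (B :==: 1); first by left.
have [/eqP-> | neBA] := boolP (B :==: A); first by right.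
case/negP: ncG.
have [sAG nAG] := andP nsAG; have [sBG nBG] := andP nsBG.
have abB := abelemS sBA abA.
have ltBA : #|B| < #|A| by rewrite proper_card // properEneq neBA.
have abGB : abelian (G / B).
  apply: contraT => ncGB.
  have := minG _ (G / B)%G (A / B)%G; rewrite leqNgt /= ltn_quotient //.
  apply; split; rewrite ?quotient_normal ?quotient_abelem //=.
  by rewrite -iAG index_quotient_eq // subIset ?sBA ?orbT.
have [rA cAA _] := and3P abA.
have [P sylP] := Sylow_exists p G.
have [sPG pP _] := and3P sylP.
have copA : coprime #|A| #|P|.
  by rewrite coprime_sym (pnat_coprime pP) // (pi_pnat rA) // !inE eq_sym.
have oP : #|P| = p.
  rewrite (card_Hall sylP) -(Lagrange sAG) iAG partnM ?cardG_gt0 ?prime_gt0 //.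
  rewrite part_p'nat ?mul1n ?part_pnat_id ?pnat_id //.
  by rewrite (pi_pnat rA) // !inE eq_sym.
have nBP := subset_trans sPG nBG.
have defG : A * P = G.
  apply/eqP; rewrite eqEcard mul_subG //= coprime_cardMg // oP -iAG.
  by rewrite Lagrange.
have cPP : abelian P by rewrite cyclic_abelian ?prime_cyclic ?oP.
have cBP : B \subset 'C(P).
  have coBP : coprime #|B| #|P| := coprimeSg sBA copA.
  suff : abelian (B <*> P).
    by rewrite abelianY => /and3P[_ _]; rewrite centsC.
  apply: contraT => ncBP.
  have := minG _ (B <*> P)%G B; rewrite leqNgt /= norm_joinEr //.
  rewrite -[#|G|](Lagrange sAG) iAG coprime_cardMg // oP.
  rewrite ltn_pmul2r ?prime_gt0 // ltBA; apply; split => //.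
    by rewrite /normal joing_subl join_subG normG.
  by rewrite -divgS ?joing_subl //= norm_joinEr // coprime_cardMg // mulKn ?oP.
have cAP : A \subset 'C(P).
  suff : A \subset 'C_A(P) by rewrite subsetI => /andP[].
  have sBC : B \subset 'C_A(P) by rewrite subsetI sBA.
  rewrite -(quotientSGK (subset_trans sAG nBG) sBC).
  rewrite coprime_quotient_cent ?abelian_sol // subsetI subxx.
  by apply: sub_abelian_cent2 abGB _ _; apply: quotientS.
by rewrite -defG abelianM cAA cPP centsC.
Qed.

(** Here [N] meets [A] trivially, so it centralizes [A]. But [A] is its own centralizer: otherwise
    [A] would be central with cyclic quotient, making [G] abelian. *)
Lemma irreducible_normal_trivial (gT : finGroupType) (G A N : {group gT})
    (ncG : ~~ abelian G) (cAA : abelian A) (nsAG : A <| G)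
    (pr_iA : prime #|G : A|)
    (irrA : forall B : {group gT}, B <| G -> B \subset A -> B :=: 1 \/ B :=: A)
    (nsNG : N <| G) (notAN : ~~ (A \subset N)) : N :=: 1.
Proof.
have [sAG nAG] := andP nsAG; have [sNG nNG] := andP nsNG.
have tiNA : N :&: A = 1.
  case: (irrA (N :&: A)%G) => [||//|/= eqA]; rewrite ?normalI ?subsetIr //.
  by case/negP: notAN; rewrite -eqA subsetIl.
have cNA : N \subset 'C(A).
  apply/commG1P/trivgP; rewrite -tiNA subsetI commg_subl commg_subr.
  by rewrite (subset_trans sAG) // (subset_trans sNG).
have maxA := p_index_maximal sAG pr_iA.
have sCA : 'C_G(A) \subset A.
  have sACG : A \subset 'C_G(A) by rewrite subsetI sAG.
  have [_ maxA'] := maxgroupP maxA.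
  have [|notGC] := boolP (G \subset 'C_G(A)); last first.
    by rewrite (maxA' ('C_G(A))%G) //= properE subsetIl.
  rewrite subsetI => /andP[_ cGA]; case/negP: ncG.
  apply: (@cyclic_factor_abelian _ A); first by rewrite subsetI sAG centsC.
  by rewrite prime_cyclic // card_quotient.
by rewrite -tiNA; apply/esym/setIidPl/(subset_trans _ sCA); rewrite subsetI sNG.
Qed.

(** * Subgroup sums and fixed vectors *)

(** For a subgroup [B] of [G] whose order is invertible in [F], this is [#|B|] times the averaging
    projection onto the [B]-fixed vectors. *)
Definition group_sum (F : fieldType) (gT : finGroupType) (G : {group gT})
    (n : nat) (rG : mx_representation F G n) (B : {set gT}) : 'M[F]_n :=
  (\sum_(x in B) rG x)%R.

Lemma rfix_mul_group_sum (F : fieldType) (gT : finGroupType) (G B : {group gT})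
    (n m : nat) (rG : mx_representation F G n) (W : 'M[F]_(m, n)) :
  (W <= rfix_mx rG B)%MS -> (W *m group_sum rG B = #|B|%:R *: W)%R.
Proof.
move/rfix_mxP => fixW; rewrite /group_sum mulmx_sumr (eq_bigr _ fixW).
by rewrite sumr_const scaler_nat.
Qed.

Lemma group_sum_mul (F : fieldType) (gT : finGroupType) (G B : {group gT})
    (n : nat) (rG : mx_representation F G n) (b : gT) :
  B \subset G -> b \in B -> (group_sum rG B *m rG b = group_sum rG B)%R.
Proof.
move=> sBG Bb; rewrite /group_sum mulmx_suml [RHS](reindex_inj (mulIg b)) /=.
apply: eq_big => [x | x Bx]; first by rewrite groupMr.
by rewrite repr_mxM ?(subsetP sBG).
Qed.

Lemma group_sum_sub_rfix (F : fieldType) (gT : finGroupType) (G B : {group gT})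
    (n : nat) (rG : mx_representation F G n) :
  B \subset G -> (group_sum rG B <= rfix_mx rG B)%MS.
Proof. by move=> sBG; apply/rfix_mxP => b; apply: group_sum_mul. Qed.

Lemma group_sumJ (F : fieldType) (gT : finGroupType) (G : {group gT})
    (B : {set gT}) (n : nat) (rG : mx_representation F G n) (g : gT) :
  B \subset G -> g \in G ->
  (group_sum rG B *m rG g = rG g *m group_sum rG (B :^ g))%R.
Proof.
move=> sBG Gg; rewrite /group_sum mulmx_suml mulmx_sumr.
rewrite [RHS](reindex_inj (conjg_inj g)) /=.
apply: eq_big => [x | x Bx]; first by rewrite memJ_conjg.
have Gx := subsetP sBG x Bx.
by rewrite -!repr_mxM ?groupJ // -conjgC.
Qed.

(* The product lies in the common fixed space of [B1] and [B2], which is the  *)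
(* fixed space of [A].                                                        *)
Lemma rfix_mul_group_sum0 (F : fieldType) (gT : finGroupType)
    (G A B1 B2 : {group gT}) (n m : nat) (rG : mx_representation F G n)
    (W : 'M[F]_(m, n)) (sAG : A \subset G) (cAA : abelian A)
    (defA : B1 <*> B2 = A) (fixA0 : rfix_mx rG A = 0%R) :
  (W <= rfix_mx rG B1)%MS -> (W *m group_sum rG B2 = 0)%R.
Proof.
move=> fixW; apply/eqP; rewrite -submx0 -fixA0.
have [sB1A sB2A] : B1 \subset A /\ B2 \subset A.
  by rewrite -defA joing_subl joing_subr.
rewrite -rfix_mx_rstabC // -{1}defA join_subG !rfix_mx_rstabC;
  rewrite ?(subset_trans _ sAG) //.
apply/andP; split; last first.
  by rewrite mulmx_sub ?group_sum_sub_rfix ?(subset_trans sB2A).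
apply/rfix_mxP=> x B1x; have Ax := subsetP sB1A x B1x.
rewrite -mulmxA group_sumJ ?(subset_trans sB2A) ?(subsetP sAG) //.
have -> : B2 :^ x = B2.
  by apply/normP/(subsetP (cent_sub _)); apply: subsetP Ax; apply: centSS cAA.
by rewrite mulmxA; have /rfix_mxP-> := fixW.
Qed.

(** As [A] is normal, its fixed vectors form a submodule, which is zero or everything. *)
Lemma irr_rfix0 (F : fieldType) (gT : finGroupType) (G A : {group gT})
    (n : nat) (rG : mx_representation F G n) (nsAG : A <| G)
    (irrG : mx_irreducible rG) (ntA : ~~ (A \subset rker rG)) :
  rfix_mx rG A = 0%R.
Proof.
apply/eqP; apply: contraR ntA => nzU.
have [_ irr] := (mx_irrP rG).1 irrG.
rewrite rfix_mx_rstabC ?normal_sub // sub1mx; apply: irr => //.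
exact: normal_rfix_mx_module.
Qed.

Lemma pgroup_card_neq0 (F : fieldType) (r : nat) (gT : finGroupType)
    (B : {group gT}) (r'F : r \notin [pchar F]%R) :
  r.-group B -> (#|B|%:R != 0 :> F)%R.
Proof.
move=> rB; rewrite natf_neq0_pchar; apply: sub_in_pnat rB => q _.
by rewrite !inE => /eqP->.
Qed.

Lemma maximal_join (gT : finGroupType) (M H L : {group gT}) :
  maximal M L -> H \subset L -> ~~ (H \subset M) -> M <*> H = L.
Proof.
move=> maxM sHL notHM; have [/proper_sub sML max] := maxgroupP maxM.
apply/eqP; apply: contraR notHM => neL.
have <- : (M <*> H)%G :=: M.
  by apply: max; rewrite ?joing_subl // properEneq neL join_subG sML.
exact: joing_subr.
Qed.

(** * From a covering maximal subgroup to unisingularity *)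

Lemma irr_hyperplane_faithful_unisingular (F : fieldType) (r : nat)
    (gT : finGroupType) (G A K : {group gT}) (n : nat)
    (rG : mx_representation F G n) (ncG : ~~ abelian G) (cAA : abelian A)
    (nsAG : A <| G) (pr_iA : prime #|G : A|)
    (irrA : forall B : {group gT}, B <| G -> B \subset A -> B :=: 1 \/ B :=: A)
    (rA : r.-group A) (r'F : r \notin [pchar F]%R)
    (irrG : mx_irreducible rG) (ntA : ~~ (A \subset rker rG))
    (maxK : maximal K A) (fixK : rfix_mx rG K != 0%R)
    (coverA : forall a, a \in A -> exists2 g, g \in G & a ^ g \in K) :
  mx_faithful rG /\ unisingular rG.
Proof.
have [sAG nAG] := andP nsAG.
have fixA0 := irr_rfix0 nsAG irrG ntA.
have sKA := proper_sub (maxgroupp maxK).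
have sKG := subset_trans sKA sAG.
have maxA := p_index_maximal sAG pr_iA.
split.
  by rewrite /mx_faithful (irreducible_normal_trivial ncG cAA nsAG pr_iA irrA
                             (rker_normal rG) ntA).
have ntK : K :!=: 1.
  have [a Aa nta] : exists2 a, a \in A & a != 1.
    by apply/trivgPn; apply: contraNneq ntA => ->; apply: sub1G.
  have [g _ Kag] := coverA a Aa.
  by apply/trivgPn; exists (a ^ g); rewrite // conjg_eq1.
have notnKG : ~~ (G \subset 'N(K)).
  apply/negP=> nKG; case: (irrA K) => [||/eqP|/eqP defK] //.
  - by rewrite /normal sKG.
  - by apply/negP.
  by have:= maxgroupp maxK; rewrite properEneq defK.
have /rowV0Pn[v fixv nzv] := fixK.
move=> g Gg; apply/eigenvalueP.
have [Ag | notAg] := boolP (g \in A).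
  have [h Gh Kgh] := coverA g Ag.
  exists (v *m rG h^-1%g)%R; last first.
    by apply: contraNneq nzv => v0; rewrite -(repr_mxKV rG Gh v) v0 mul0mx.
  rewrite scale1r -mulmxA -repr_mxM ?groupV //.
  have -> : h^-1 * g = g ^ h * h^-1 by rewrite /conjg !mulgA mulgK.
  by rewrite repr_mxM ?groupJ ?groupV // mulmxA; have /rfix_mxP-> := fixv.
pose C := <[g]>%G.
have sCG : C \subset G by rewrite cycle_subG.
have defG : A <*> C = G.
  by apply: maximal_join => //; rewrite cycle_subG.
(* Both [A] and [C] are abelian and together generate [G], so [C :&: A] is normal; if it were [A],
   then [G = C] would be cyclic. *)
have tiCA : C :&: A = 1.
  case: (irrA (C :&: A)%G) => [||//|/= defA]; rewrite ?subsetIr //.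
    rewrite /normal subIset ?sCG //= -defG join_subG; apply/andP; split.
      by rewrite sub_abelian_norm ?subsetIr.
    by rewrite sub_abelian_norm ?subsetIl ?cycle_abelian.
  case/negP: ncG; rewrite -defG.
  have sAC : A \subset C by rewrite -defA subsetIl.
  by have /joing_idPr-> := sAC; apply: cycle_abelian.
exists (v *m group_sum rG C)%R.
  by rewrite scale1r -mulmxA group_sum_mul ?cycle_id.
apply/eqP => w0.
(* Multiplying by the sum of [K] isolates the term at [1]: for [h != 1] in [C] the translate of [v]
   is fixed by [K :^ h], which differs from [K] because [A] and [h] generate [G]. *)
have : (v *m group_sum rG C *m group_sum rG K = #|K|%:R *: v)%R.
  rewrite -mulmxA [group_sum rG C]/group_sum mulmx_suml mulmx_sumr.
  rewrite (bigD1 1) ?group1 //= repr_mx1 mul1mx rfix_mul_group_sum //.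
  rewrite big1 => [|h]; first by rewrite addr0.
  case/andP=> Ch nth; have Gh := subsetP sCG h Ch.
  have notAh : h \notin A.
    by apply: contra nth => Ah; rewrite -in_set1 -[[set 1]]tiCA inE Ch.
  rewrite mulmxA.
  apply: (@rfix_mul_group_sum0 _ _ _ _ (K :^ h)%G K _ _ _ _ sAG cAA) => //.
    rewrite joingC; apply: maximal_join => //.
      by rewrite -(normsP nAG h Gh) conjSg.
    apply: contra notnKG => sKhK.
    rewrite -(maximal_join (H := <[h]>) maxA) ?cycle_subG // join_subG.
    by rewrite sub_abelian_norm // cycle_subG inE.
  by rewrite rfix_mx_conjsg // submxMr.
rewrite w0 mul0mx => /esym/eqP; rewrite scaler_eq0 (negPf nzv) orbF.
by apply/negP/(pgroup_card_neq0 r'F); apply: pgroupS rA.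
Qed.

(** * The permutation module *)

Definition action_mx (F : fieldType) (gT : finGroupType) (G : {group gT})
    (D : finType) (to : action G D) (g : gT) : 'M[F]_#|D| :=
  (\matrix_(i, j) (to (enum_val i) g == enum_val j)%:R)%R.

Lemma mul_action_mxE (F : fieldType) (gT : finGroupType) (G : {group gT})
    (D : finType) (to : action G D) (m : nat) (u : 'M[F]_(m, #|D|)) (g : gT)
    (i : 'I_m) (x : D) :
  ((u *m action_mx F to g) i (enum_rank (to x g)) = u i (enum_rank x))%R.
Proof.
rewrite mxE (bigD1 (enum_rank x)) //= mxE !enum_rankK eqxx mulr1.
rewrite big1 ?addr0 // => j neq_j; rewrite mxE enum_rankK.
rewrite (inj_eq (act_inj to g)) -(inj_eq enum_rank_inj) enum_valK.
by rewrite (negPf neq_j) mulr0.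
Qed.

Lemma action_mx_repr (F : fieldType) (gT : finGroupType) (G : {group gT})
    (D : finType) (to : action G D) : mx_repr G (action_mx F to).
Proof.
split=> [|g h Gg Gh].
  by apply/matrixP=> i j; rewrite !mxE act1 (inj_eq enum_val_inj).
apply/matrixP=> i j.
have [y ->] : exists y, j = enum_rank (to y h).
  by exists (to (enum_val j) h^-1); rewrite actKVin ?enum_valK.
rewrite mul_action_mxE !mxE !enum_rankK actMin //.
by rewrite (inj_eq (act_inj to h)).
Qed.

Lemma exists_irr_rfix (F : fieldType) (gT : finGroupType) (G A B : {group gT})
    (D : finType) (to : action G D) (x : D) (nsAG : A <| G)
    (nzA : (#|A|%:R != 0 :> F)%R) (nzB : (#|B|%:R != 0 :> F)%R)
    (trG : [transitive G, on [set: D] | to])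
    (ntA : ~~ (A \subset 'C([set: D] | to)))
    (sBG : B \subset G) (sBx : B \subset 'C[x | to]) :
  exists (n : nat) (rG : mx_representation F G n),
    [/\ mx_irreducible rG, ~~ (A \subset rker rG) & rfix_mx rG B != 0%R].
Proof.
pose rG := MxRepresentation (action_mx_repr F to).
have [sAG nAG] := andP nsAG.
(* On a submodule of [M] with trivial [A]-action, multiplication by [#|A|] would be zero; so simple
   submodules of [M] are nontrivial on [A]. *)
pose M := kermx (group_sum rG A).
have modM : mxmodule rG M.
  apply/mxmoduleP=> g Gg; rewrite sub_kermx -mulmxA.
  by rewrite -{1}(normsP nAG g Gg) -group_sumJ // mulmxA mulmx_ker mul0mx.
have nzM : M != 0%R.
  apply: contraNneq ntA => M0; apply/subsetP=> a Aa.
  have Ga := subsetP sAG a Aa.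
  have : ((1%:M - rG a)%R <= M)%MS.
    rewrite sub_kermx mulmxBl mul1mx -{2}(normsP nAG a Ga) -group_sumJ //.
    by rewrite group_sum_mul // subrr.
  rewrite M0 submx0 subr_eq0 => /eqP ra1.
  rewrite !inE Ga; apply/subsetP=> y _; rewrite inE.
  have := congr1 (fun W : 'M_#|D| => W (enum_rank y) (enum_rank y)) ra1.
  rewrite !mxE eqxx !enum_rankK; case: eqP => // _ /eqP.
  by rewrite oner_eq0.
(* Over an arbitrary field [mxsimple_exists] holds only under [classically]; excluded middle
   extracts the witness. *)
have [U simU sUM] := NNPP _ ((classicP _).1 (mxsimple_exists modM nzM)).
have [modU nzU _] := simU.
exists (\rank U), (submod_repr modU); split; first exact/submod_mx_irr.
  rewrite rker_submod rfix_mx_rstabC //; apply: contra nzU => fixU.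
  have := rfix_mul_group_sum fixU; rewrite (sub_kermxP sUM) => /esym/eqP.
  by rewrite scaler_eq0 (negPf nzA).
have /rowV0Pn[u sUu nzu] := nzU.
have /rV0Pn[j nzuj] := nzu.
have [g Gg xg] : exists2 g, g \in G & x = to (enum_val j) g.
  exact: atransP2in (subxx G) trG _ _ (in_setT _) (in_setT _).
(* Translating by [g] moves the nonzero coordinate of [u] to the point [x]; summing over [B] makes
   the vector [B]-fixed. *)
pose w := (u *m rG g *m group_sum rG B)%R.
have sUw : (w <= U)%MS.
  rewrite /w /group_sum mulmx_sumr summx_sub // => b Bb.
  by rewrite (mxmodule_trans modU (subsetP sBG b Bb)) ?(mxmodule_trans modU Gg).
have fixw : (w <= rfix_mx rG B)%MS by rewrite mulmx_sub ?group_sum_sub_rfix.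
(* [B] fixes [x], so the coordinate at [x] of each term of [w] is [u 0 j]. *)
have nzw : w != 0%R.
  apply: contraNneq nzuj => w0.
  have : (w 0 (enum_rank x) = #|B|%:R * u 0 j)%R.
    rewrite /w /group_sum mulmx_sumr summxE mulr_natl -sumr_const.
    apply: eq_bigr => b Bb.
    have {1}<- : to x b = x by apply: (astab_act (subsetP sBx b Bb) (set11 x)).
    by rewrite mul_action_mxE xg mul_action_mxE enum_valK.
  by rewrite w0 mxE => /esym/eqP; rewrite mulf_eq0 (negPf nzB).
apply/rowV0Pn; exists (in_submod U w).
  apply/rfix_mxP=> b Bb; apply: (can_inj (@val_submodK _ _ U 1)).
  rewrite val_submodJ ?(subsetP sBG) // in_submodK //.
  by have /rfix_mxP-> := fixw.
by rewrite -(val_submod_eq0 (U := U)) in_submodK.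
Qed.

(** * From a unisingular representation to a covering maximal subgroup *)

(** [K] is the kernel of [A] on a simple submodule: [A / K] is abelian with a faithful irreducible
    representation, hence cyclic. When [A] is elementary abelian this bounds the index of [K] by
    [r]. *)
Lemma exists_cocyclic_rfix (F : fieldType) (gT : finGroupType) (A : {group gT})
    (n : nat) (rA : mx_representation F A n)
    (n_gt0 : 0 < n) (cAA : abelian A) (fixA0 : rfix_mx rA A = 0%R) :
  exists K : {group gT},
    [/\ K <| A, cyclic (A / K), K :!=: A & rfix_mx rA K != 0%R].
Proof.
have nz1 : (1%:M != 0 :> 'M[F]_n)%R by rewrite -mxrank_eq0 mxrank1 -lt0n.
have [U simU _] :=
  NNPP _ ((classicP _).1 (mxsimple_exists (mxmodule1 rA) nz1)).
have [modU nzU _] := simU.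
have irrU := (submod_mx_irr modU).2 simU.
have fixU (B : {set gT}) : B \subset rstab rA U -> rfix_mx rA B != 0%R.
  move=> sBU; apply: contraNneq nzU => fixB0.
  rewrite -submx0 -fixB0 -rfix_mx_rstabC //.
  exact: subset_trans sBU (rstab_sub _ _).
exists (rker (submod_repr modU))%G; split; first exact: rker_normal.
- have := center_kquo_cyclic irrU.
  by rewrite (center_idP (quotient_abelian _ cAA)).
- apply/eqP=> /= defA; have := fixU A.
  by rewrite -rker_submod defA fixA0 eqxx => /(_ (subxx _)).
by apply: fixU; rewrite /= rker_submod.
Qed.

Lemma unisingular_cover (F : fieldType) (r : nat) (gT : finGroupType)
    (G A K : {group gT}) (n : nat) (rG : mx_representation F G n)
    (sAG : A \subset G) (nAG : G \subset 'N(A)) (cAA : abelian A)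
    (rA : r.-group A) (r'F : r \notin [pchar F]%R)
    (irrG : mx_irreducible rG) (fixA0 : rfix_mx rG A = 0%R)
    (maxK : maximal K A) (fixK : rfix_mx rG K != 0%R) (a : gT) :
  a \in A -> eigenvalue (rG a) 1%R -> exists2 g, g \in G & a ^ g \in K.
Proof.
move=> Aa /eigenvalueP[v]; rewrite scale1r => va nzv.
have sKA := proper_sub (maxgroupp maxK).
pose C := <[a]>%G.
have sCA : C \subset A by rewrite cycle_subG.
have sCG := subset_trans sCA sAG.
have [/exists_inP[g Gg Kag] | noK] := boolP [exists g in G, a ^ g \in K].
  by exists g.
(* The largest submodule killed by the sum of [C]. If no conjugate of [a] lies in [K], it contains
   the [K]-fixed vectors, so it is everything; but that sum multiplies the [a]-fixed vector [v] by
   [#|C|]. *)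
pose M := (\bigcap_(g in G) kermx (rG g *m group_sum rG C))%MS.
have modM : mxmodule rG M.
  apply/mxmoduleP=> h Gh; apply/sub_bigcapmxP=> g Gg; rewrite sub_kermx.
  rewrite mulmxA -[(M *m _ *m _)%R]mulmxA -repr_mxM // -mulmxA -sub_kermx.
  by apply: (bigcapmx_inf (h * g)); rewrite ?groupM.
have sKM : (rfix_mx rG K <= M)%MS.
  apply/sub_bigcapmxP=> g Gg; rewrite sub_kermx mulmxA; apply/eqP.
  apply: (@rfix_mul_group_sum0 _ _ _ _ (K :^ g)%G C _ _ _ _ sAG cAA) => //.
    apply: maximal_join => //; first by rewrite -(normsP nAG g Gg) maximalJ.
    apply: contra noK; rewrite cycle_subG mem_conjg => Kag.
    by apply/exists_inP; exists g^-1; rewrite ?groupV.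
  by rewrite rfix_mx_conjsg ?(subset_trans sKA).
have fullM : row_full M.
  have [_ irr] := (mx_irrP rG).1 irrG; apply: irr => //.
  by apply: contraNneq fixK => M0; rewrite -submx0 -M0.
have : (v *m group_sum rG C = #|C|%:R *: v)%R.
  apply: rfix_mul_group_sum; apply/rfix_mxP=> _ /cycleP[i ->].
  have Ga : a \in G by apply: subsetP Aa.
  elim: i => [|i IHi]; first by rewrite repr_mx1 mulmx1.
  by rewrite expgS repr_mxM ?groupX // mulmxA va.
have -> : (v *m group_sum rG C = 0)%R.
  apply/sub_kermxP; apply: submx_trans (submx_full v fullM) _.
  by apply: (bigcapmx_inf 1); rewrite // repr_mx1 mul1mx.
have nzC := pgroup_card_neq0 r'F (pgroupS sCA rA).
by move/esym/eqP; rewrite scaler_eq0 (negPf nzv) (negPf nzC).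
Qed.

(** * The action on the right cosets of [K] *)

Lemma astab_setT_normal (gT : finGroupType) (G : {group gT}) (D : finType)
    (to : action G D) : 'C_G([set: D] | to) <| G.
Proof.
have actsG : 'N([set: D] | to) = G.
  apply/eqP; rewrite eqEsubset; apply/andP; split.
    by apply/subsetP=> g; rewrite inE => /andP[].
  apply/subsetP=> g Gg; rewrite !inE Gg.
  by apply/subsetP=> y; rewrite !inE.
have := astab_normal to [set: D]; rewrite actsG => nsC.
by rewrite (setIidPr (normal_sub nsC)).
Qed.

Lemma coset_action_exists (r : nat) (gT : finGroupType) (G A K : {group gT})
    (nsAG : A <| G) (hallA : r.-Hall(G) A)
    (sKA : K \subset A) (iK : #|A : K| <= r)
    (tiK : forall N : {group gT}, N <| G -> N \subset K -> N :=: 1)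
    (coverA : forall a, a \in A -> exists2 g, g \in G & a ^ g \in K) :
  exists (Delta : finType) (to : action G Delta),
    [/\ [transitive G, on [set: Delta] | to],
        [faithful G, on [set: Delta] | to],
        restricted_action r to
      & forall g, g \in G -> r.-elt g -> exists x : Delta, to x g = x].
Proof.
have [sAG nAG] := andP nsAG.
have sKG := subset_trans sKA sAG.
pose D := {C : {set gT} | C \in rcosets K G}.
have sGD : G \subset subact_dom (fun C => C \in rcosets K G) 'Rs.
  apply/subsetP=> g Gg; rewrite !inE; apply/subsetP=> C; rewrite !inE.
  case/rcosetsP=> h Gh ->.
  by rewrite /= rcosetE -rcosetM -rcosetE imset_f ?groupM.
pose to : action G D := ('Rs^? \ sGD)%act.
have toE (C : D) g : g \in G -> val (to C g) = val C :* g.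
  by move=> Gg; rewrite /= val_subact (subsetP sGD) //= rcosetE.
have KG g : g \in G -> K :* g \in rcosets K G.
  by move=> Gg; rewrite -rcosetE imset_f.
pose coset g (Gg : g \in G) : D := Sub (K :* g) (KG g Gg).
have elemD (C : D) : exists2 g, g \in G & val C = K :* g.
  by have /rcosetsP[g Gg] := valP C; exists g.
have fixE (C : D) g h : h \in G -> g \in G -> val C = K :* g ->
    (to C h == C) = (h ^ g^-1 \in K).
  move=> Gh Gg defC; rewrite -val_eqE toE // defC -rcosetM.
  rewrite (sameP eqP rcoset_eqP) mem_rcoset.
  by rewrite /conjg invgK mulgA.
exists D, to; split.
- apply/imsetP; exists (coset 1 (group1 G)); rewrite ?inE //.
  apply/setP=> C; rewrite inE; apply/esym/imsetP.
  have [g Gg defC] := elemD C; exists g => //.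
  by apply: val_inj; rewrite toE //= mulg1 defC.
- rewrite /faithful (tiK 'C_G([set: D] | to)%G) //=.
    exact: astab_setT_normal.
  apply/subsetP=> g /setIP[Gg /astab_act/(_ (in_setT (coset 1 (group1 G))))].
  by move/eqP; rewrite (@fixE _ 1) // invg1 conjg1.
- move=> B sBG abB C.
  have sBA : B \subset A.
    by rewrite (sub_normal_Hall hallA) //; case/and3P: abB.
  have [g Gg defC] := elemD C.
  apply: leq_trans iK; rewrite -(card_imset _ val_inj).
  (* As [K :* g :* b] equals [K :* (b ^ g^-1) :* g] and [A] is normal, the [B]-orbit of [K :* g]
     lies among the [g]-translates of the cosets of [K] in [A]. *)
  apply: leq_trans (leq_imset_card (fun E : {set gT} => E :* g) (rcosets K A)).
  apply: subset_leq_card; apply/subsetP=> _ /imsetP[_ /imsetP[b Bb ->] ->].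
  have Ab := subsetP sBA b Bb.
  apply/imsetP; exists (K :* (b ^ g^-1)).
    by rewrite -rcosetE imset_f // memJ_norm // (subsetP nAG) ?groupV.
  by rewrite toE ?(subsetP sBG) // defC -!rcosetM -conjgCV.
move=> g Gg rg.
have Ag : g \in A by rewrite (mem_normal_Hall hallA).
have [h Gh Kgh] := coverA g Ag.
exists (coset h^-1 (groupVr Gh)); apply/eqP.
by rewrite (fixE _ h^-1) ?invgK ?groupV.
Qed.

(** * Point stabilizers in [A] and the equivalence *)

Theorem lemma1p5 (p r : nat) (F : fieldType) (gT : finGroupType)
    (G : {group gT}) (hp : prime p) (hr : prime r) (hpr : p != r)
    (hF : r \notin [pchar F]%R) (hG : minimal_nonabelian_ext r p G) :
  (exists (n : nat) (rG : mx_representation F G n),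
     [/\ mx_faithful rG, mx_irreducible rG & unisingular rG])
  <->
  (exists (Delta : finType) (to : action G Delta),
     [/\ [transitive G, on [set: Delta] | to],
         [faithful G, on [set: Delta] | to],
         restricted_action r to
       & forall g, g \in G -> r.-elt g -> exists x : Delta, to x g = x]).
Proof.
have [[A extG] minG] := hG.
have irrA (B : {group gT}) :=
  minimal_ext_irreducible hp hpr minG extG (B := B).
have [ncG nsAG abA iA] := extG.
have [sAG nAG] := andP nsAG.
have [rA cAA _] := and3P abA.
have pr_iA : prime #|G : A| by rewrite iA.
have hallA : r.-Hall(G) A.
  by rewrite /pHall sAG rA iA pnatE // !inE.
have ntA : A :!=: 1.
  apply: contraNneq ncG => A1.
  by rewrite cyclic_abelian // prime_cyclic // -indexg1 -A1 iA.
(* The index is a power of [r], above [1] and at most [r], so it is [r]. *)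
have index_prime (K : {group gT}) :
    K \subset A -> #|A : K| <= r -> ~~ (A \subset K) -> prime #|A : K|.
  move=> sKA leKr notAK.
  have gt1 : 1 < #|A : K| by rewrite indexg_gt1.
  have /p_natP[k defk] : r.-nat #|A : K|.
    exact: pnat_dvd (dvdn_indexg _ _) rA.
  rewrite defk -[leqRHS]expn1 leq_exp2l ?prime_gt1 // in leKr.
  rewrite defk in gt1 *.
  by case: k leKr gt1 {defk} => [|[|]].
split=> [[n [rG [fG irrG unisG]]] | [D [to [trG fG restr fixG]]]].
  have ntAr : ~~ (A \subset rker rG).
    by apply: contra ntA => /subset_trans/(_ fG)/trivgP->.
  have fixA0 := irr_rfix0 nsAG irrG ntAr.
  have n_gt0 : 0 < n by have [] := (mx_irrP rG).1 irrG.
  have [K [nsKA cycAK neKA fixK]] :=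
    exists_cocyclic_rfix (rA := subg_repr rG sAG) n_gt0 cAA fixA0.
  rewrite rfix_subg in fixK.
  have [sKA nKA] := andP nsKA.
  have notAK : ~~ (A \subset K).
    by apply: contra neKA => sAK; rewrite eqEsubset sKA.
  have iK : #|A : K| <= r.
    have abAK := quotient_abelem K abA.
    rewrite -card_quotient // (card_pgroup (abelem_pgroup abAK)).
    by rewrite -[leqRHS]expn1 leq_exp2l ?prime_gt1 // -(abelem_cyclic abAK).
  have maxK := p_index_maximal sKA (index_prime K sKA iK notAK).
  have coverA a (Aa : a \in A) :=
    unisingular_cover sAG nAG cAA rA hF irrG fixA0 maxK fixK Aa
      (unisG a (subsetP sAG a Aa)).
  apply: (coset_action_exists nsAG hallA sKA iK _ coverA) => N nsNG sNK.
  case: (irrA N nsNG (subset_trans sNK sKA)) => // defN.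
  by case/negP: notAK; rewrite -defN.
have [x _ _] := imsetP trG.
have ntAC : ~~ (A \subset 'C([set: D] | to)).
  apply: contra ntA => cA; rewrite -subG1; apply: subset_trans fG.
  by rewrite subsetI sAG.
pose K := 'C_A[x | to]%G.
have orbx y : exists2 g, g \in G & y = to x g.
  exact: atransP2in (subxx G) trG _ _ (in_setT _) (in_setT _).
have sKA : K \subset A := subsetIl _ _.
have iK : #|A : K| <= r by rewrite -(card_orbit_in to x sAG) restr.
(* If [A] fixed [x], then being normal it would fix every point of the transitive set [D]. *)
have notAK : ~~ (A \subset K).
  apply: contra ntAC; rewrite subsetI => /andP[_ cAx].
  apply/subsetP=> a Aa; rewrite !inE (subsetP sAG) //=.
  apply/subsetP=> y _; rewrite inE; have [g Gg ->] := orbx y.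
  apply/eqP; apply: (astab_act _ (set11 _)).
  rewrite astab1_act_in //; apply: subsetP Aa.
  by rewrite -(normsP nAG g Gg) conjSg.
have maxK := p_index_maximal sKA (index_prime K sKA iK notAK).
(* A fixed point of [a] has the form [to x g], so [a ^ g^-1] fixes [x]. *)
have coverA a : a \in A -> exists2 g, g \in G & a ^ g \in K.
  move=> Aa; have Ga := subsetP sAG a Aa.
  have [y ya] := fixG a Ga (mem_p_elt rA Aa).
  have [g Gg defy] := orbx y; exists g^-1; rewrite ?groupV //.
  rewrite inE memJ_norm ?Aa ?(subsetP nAG) ?groupV // -mem_conjg.
  rewrite -astab1_act_in // -defy !inE Ga.
  by apply/subsetP=> z /set1P->; rewrite inE ya.
have [n [rG [irrG ntAr fixK]]] :=
  exists_irr_rfix nsAG (pgroup_card_neq0 hF rA)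
    (pgroup_card_neq0 hF (pgroupS sKA rA)) trG ntAC
    (subset_trans sKA sAG) (subsetIr _ _).
exists n, rG.
by have [] := irr_hyperplane_faithful_unisingular ncG cAA nsAG pr_iA irrA rA hF
                irrG ntAr maxK fixK coverA.
Qed.
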